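(* Let $\Omega\subseteq\mathbb{C}^n$ be a bounded, convex, $d$-balanced domain, $d=(d_1,\dots,d_n)$, and let $L=\max_{1\leq i\leq n}d_i$. Let $a\in\mathbb{R}$, let $a\Omega=\{az:z\in\Omega\}$, and let $B_{a\Omega}>0$ be a constant such that $h_{d,\Omega}(z)\leq B_{a\Omega}$ for every $z\in a\Omega$. Then for every $z\in a\Omega$, $$h_{d,\Omega}(z)\leq B_{a\Omega}\left(\tanh \tilde{k}_{a\Omega}(0,z)\right)^{1/L},$$ where $\tilde{k}_{a\Omega}$ denotes the Lempert function of $a\Omega$.
   Context: Let $n\geq 2$ and let $d=(d_1,\dots,d_n)$ be an $n$-tuple of positive integers. A domain $\Omega\subseteq\mathbb{C}^n$ is $d$-balanced if for each $z=(z_1,\dots,z_n)\in\Omega$ and each $\lambda\in\mathbb{C}$ with $|\lambda|\leq 1$ one has $(\lambda^{d_1}z_1,\dots,\lambda^{d_n}z_n)\in\Omega$. Its $d$-Minkowski function on $\mathbb{C}^n$ is $$h_{d,\Omega}(z):=\inf\left\{t>0:\left(\frac{z_1}{t^{d_1}},\dots,\frac{z_n}{t^{d_n}}\right)\in\Omega\right\}.$$ With $\mathbb{D}$ the open unit disc in $\mathbb{C}$ and $\rho$ the Poincaré distance on $\mathbb{D}$ normalized by $\rho(0,\sigma)=\tanh^{-1}|\sigma|$, the Lempert function is $$\tilde{k}_{G}(0,z)=\inf\{\rho(0,\sigma): \sigma\in\mathbb{D},\ \text{there is a holomorphic } \phi:\mathbb{D}\to G \text{ with } \phi(0)=0,\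 \phi(\sigma)=z\}.$$ This formula is used for $G=a\Omega$ for every real $a$ (including $a=0$, where $a\Omega=\{0\}$ and the value is $0$). *)

(* Defs.v *)
From HB Require Import structures.
From mathcomp Require Import all_boot all_order all_algebra.
From mathcomp Require Import all_classical all_reals all_analysis.
From mathcomp Require Import complex.

Set Implicit Arguments.
Unset Strict Implicit.
Unset Printing Implicit Defensive.

Import Order.TTheory GRing.Theory Num.Theory.
Import numFieldNormedType.Exports.

Local Open Scope classical_set_scope.
Local Open Scope ring_scope.

(* [R[i]] packed as a [numClosedFieldType]: the topology and the norm that
   MathComp-Analysis attaches to an abstract numFieldType then apply to it and
   to ['rV[Cplx R]_n] (product topology, sup norm).  The order is the partial
   order of [R[i]]: [x <= y] iff [y - x] is a nonnegative real, and [`|x|] is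
   the modulus, seen as an element of [R[i]]. *)
Definition Cplx (R : realType) : numClosedFieldType := R[i].

Definition real_to_C (R : realType) (x : R) : Cplx R := (x%:C)%C.

(* The modulus as an element of [R]. *)
Definition modulus (R : realType) (z : Cplx R) : R := complex.Re `|z|.

Definition is_domain (R : realType) (n : nat) (Om : set 'rV[Cplx R]_n) :=
  [/\ open Om, connected Om & Om !=set0].

Definition weighted_dilation (R : realType) (n : nat) (d : 'I_n -> nat)
    (lam : Cplx R) (z : 'rV[Cplx R]_n) : 'rV[Cplx R]_n :=
  \row_i (lam ^+ d i * z ord0 i).

Definition d_balanced (R : realType) (n : nat) (d : 'I_n -> nat)
    (Om : set 'rV[Cplx R]_n) :=
  forall (z : 'rV[Cplx R]_n) (lam : Cplx R),
    Om z -> `|lam| <= 1 -> Om (weighted_dilation d lam z).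

(* [inf] is real-valued; it is the genuine infimum as soon as the set is
   nonempty, which is the case whenever [Om] is a neighbourhood of 0. *)
Definition minkowski_fun (R : realType) (n : nat) (d : 'I_n -> nat)
    (Om : set 'rV[Cplx R]_n) (z : 'rV[Cplx R]_n) : R :=
  inf [set t : R | 0 < t /\ Om (\row_i (z ord0 i / real_to_C t ^+ d i))].

(* [convex_set] is taken over the scalars [Cplx R]; the weights [t] satisfy
   [0 <= t <= 1] in the order of [R[i]], hence are real, so this is the usual
   convexity of subsets of the real vector space C^n. *)
Definition convexC (R : realType) (n : nat) (Om : set 'rV[Cplx R]_n) :=
  convex_set Om.

Definition scale_set (R : realType) (n : nat) (a : R)
    (Om : set 'rV[Cplx R]_n) : set 'rV[Cplx R]_n :=
  [set real_to_C a *: z | z in Om].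

Definition unit_disc (R : realType) : set (Cplx R) := [set z | `|z| < 1].

(* Maps on the disc are represented by total functions whose values outside
   the disc are irrelevant; [derivable phi z 1] is complex differentiability
   at [z], as the scalars are [Cplx R]. *)
Definition holomorphic_disc (R : realType) (n : nat) (G : set 'rV[Cplx R]_n)
    (phi : Cplx R -> 'rV[Cplx R]_n) :=
  forall z : Cplx R, unit_disc z -> G (phi z) /\ derivable phi z 1.

Definition tanh (R : realType) (x : R) : R :=
  (expR x - expR (- x)) / (expR x + expR (- x)).

Definition artanh (R : realType) (x : R) : R :=
  2^-1 * ln ((1 + x) / (1 - x)).

(* Normalized so that [poincare 0 s = artanh (modulus s)]. *)
Definition poincare (R : realType) (z w : Cplx R) : R :=
  artanh (modulus ((z - w) / (1 - z^* * w))).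

(* As for [minkowski_fun], the real-valued [inf] is the genuine infimum when some
   holomorphic disc in [G] centred at [w] passes through [z]. *)
Definition lempert (R : realType) (n : nat) (G : set 'rV[Cplx R]_n)
    (w z : 'rV[Cplx R]_n) : R :=
  inf [set poincare 0 s | s in [set s : Cplx R | unit_disc s /\
    exists phi : Cplx R -> 'rV[Cplx R]_n,
      [/\ holomorphic_disc G phi, phi 0 = w & phi s = z]]].

(* Main.v *)
(* Given a disc [phi] in [a Om] with [phi 0 = 0], the map
   [psi_i(mu) = phi_i(mu^L) / mu^(d i)] is holomorphic off 0 and continuous at 0,
   because [d i <= L] and [phi_i] vanishes at 0.  It is the [d]-dilation of
   [phi(mu^L)] by [1/mu], so [h (psi mu) = h (phi (mu^L)) / |mu| <= B / r] on
   the circle [|mu| = r].  The sublevel sets of [h] are convex, being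
   [d]-dilations of [Om], so composing with separating linear functionals, the
   maximum principle and [r -> 1] give [h (psi mu) <= B] on the disc, i.e.
   [h (phi s) <= B |s|^(1/L)].

   The maximum principle for complex differentiable functions comes from the
   mean value property: in logarithmic polar coordinates [z0 + exp (x + i y)],
   Goursat's bisection shows that the mean over a period in [y] does not depend
   on [x]. *)
Require Import Defs.
From HB Require Import structures.
From mathcomp Require Import all_boot all_order all_algebra.
From mathcomp Require Import all_classical all_reals all_analysis.
From mathcomp Require Import complex.
From mathcomp Require Import ring lra.

Set Implicit Arguments.
Unset Strict Implicit.
Unset Printing Implicit Defensive.

Import Order.TTheory GRing.Theory Num.Theory.
Import numFieldNormedType.Exports.

Local Open Scope classical_set_scope.
Local Open Scope ring_scope.

(** * Goursat's lemma *)

Section segment_integral.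
Context {R : realType}.
Implicit Types (g : R -> R) (a b c : R).

Definition seg_int g a b : R := \int[@lebesgue_measure R]_(t in `[a, b]) g t.

(** Continuity at the endpoints is two-sided: the integrands below are continuous on a neighbourhood
    of the segment. *)
Definition continuous_on_seg g a b :=
  forall t, a <= t <= b -> {for t, continuous g}.

Lemma continuous_on_segB g1 g2 a b : continuous_on_seg g1 a b ->
  continuous_on_seg g2 a b -> continuous_on_seg (fun t => g1 t - g2 t) a b.
Proof.
move=> c1 c2 t tab; exact: (@continuousB _ _ _ g1 g2 t (c1 t tab) (c2 t tab)).
Qed.

Lemma seg_integrable g a b : continuous_on_seg g a b ->
  (@lebesgue_measure R).-integrable `[a, b]%classic (EFin \o g).
Proof.
move=> cg; apply: continuous_compact_integrable; first exact: segment_compact.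
by apply: continuous_in_subspaceT => t; rewrite inE/= in_itv/=; exact: cg.
Qed.

Lemma seg_intB g1 g2 a b :
  continuous_on_seg g1 a b -> continuous_on_seg g2 a b ->
  seg_int (fun t => g1 t - g2 t) a b = seg_int g1 a b - seg_int g2 a b.
Proof. by move=> c1 c2; apply: RintegralB => //; exact: seg_integrable. Qed.

Lemma seg_int_cat g a b c : a <= b -> b <= c -> continuous_on_seg g a c ->
  seg_int g a c = seg_int g a b + seg_int g b c.
Proof.
move=> ab bc cg; apply/eqP; rewrite addrC -subr_eq; apply/eqP.
rewrite /seg_int Rintegral_itvB ?bnd_simp//; last exact: seg_integrable.
rewrite Rintegral_itv_obnd_cbnd//.
have ig := seg_integrable cg.
apply: integrableS ig => //.
by move=> t /=; rewrite !in_itv/= => /andP[bt ->]; rewrite andbT (le_trans ab)// ltW.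
Qed.

Lemma seg_int_cst k a b : a <= b -> seg_int (cst k) a b = k * (b - a).
Proof.
move=> ab; rewrite /seg_int Rintegral_cst//= lebesgue_measure_itv/= lte_fin.
by case: ltgtP ab => //= -> _; rewrite subrr.
Qed.

Lemma seg_int_le g a b k : a <= b -> continuous_on_seg g a b ->
  (forall t, a <= t <= b -> g t <= k) -> seg_int g a b <= k * (b - a).
Proof.
move=> ab cg gk; rewrite -seg_int_cst//; apply: le_Rintegral => //.
- exact: seg_integrable.
- by apply: seg_integrable => t _; exact: cst_continuous.
Qed.

Lemma seg_int_ge g a b k : a <= b -> continuous_on_seg g a b ->
  (forall t, a <= t <= b -> k <= g t) -> k * (b - a) <= seg_int g a b.
Proof.
move=> ab cg gk; rewrite -seg_int_cst//; apply: le_Rintegral => //.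
- by apply: seg_integrable => t _; exact: cst_continuous.
- exact: seg_integrable.
Qed.

Lemma seg_int_dist g a b k e : a <= b -> continuous_on_seg g a b ->
  (forall t, a <= t <= b -> `|g t - k| <= e) ->
  `|seg_int g a b - k * (b - a)| <= e * (b - a).
Proof.
move=> ab cg gk; rewrite ler_norml.
have := @seg_int_le g a b (k + e) ab cg; have := @seg_int_ge g a b (k - e) ab cg.
move=> H1 H2; apply/andP; split.
- rewrite lerBrDr -mulNr -mulrDl addrC; apply: H1 => t /gk.
  by rewrite ler_norml => /andP[H _]; lra.
- rewrite lerBlDr -mulrDl addrC; apply: H2 => t /gk.
  by rewrite ler_norml => /andP[_ H]; lra.
Qed.

End segment_integral.

(** * Circulation around squares and Goursat's bisection *)

Section goursat.
Context {R : realType}.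
Implicit Types (U V : R -> R -> R).

(** Total differentiability at one point with gradient [(p, q)]. The error is measured in the l1
    norm, so exchanging the variables only permutes terms. *)
Definition frechet_at U x0 y0 p q := forall e, 0 < e -> exists2 dl, 0 < dl &
  forall x y, `|x - x0| < dl -> `|y - y0| < dl ->
    `|U x y - U x0 y0 - (p * (x - x0) + q * (y - y0))| <=
    e * (`|x - x0| + `|y - y0|).

Lemma frechet_swap U x0 y0 p q : frechet_at U x0 y0 p q ->
  frechet_at (fun y x => U x y) y0 x0 q p.
Proof.
move=> fU e /fU[dl dl0 H]; exists dl => // x y hx hy.
by rewrite (addrC (q * _)) (addrC `|x - _|); exact: H.
Qed.

Lemma frechet_continuousl U x0 y0 p q : frechet_at U x0 y0 p q ->
  {for x0, continuous (fun x => U x y0)}.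
Proof.
move=> fU; have [dl dl0 H] := fU 1 ltr01.
apply/(@cvgrPdist_le _ R) => e e0.
have k0 : 0 < `|p| + 1 by rewrite ltr_wpDl.
near=> x.
have xdl : `|x - x0| < dl.
  by rewrite distrC; near: x; exact: (@cvgr_dist_lt _ R).
have xe : `|x - x0| < e / (`|p| + 1).
  by rewrite distrC; near: x; apply: (@cvgr_dist_lt _ R) => //; rewrite divr_gt0.
have := H x y0 xdl; rewrite subrr normr0 => /(_ dl0).
rewrite mulr0 addr0 mul1r addr0 => h.
rewrite distrC.
have -> : U x y0 - U x0 y0 = (U x y0 - U x0 y0 - p * (x - x0)) + p * (x - x0) by ring.
rewrite (le_trans (ler_normD _ _))// (le_trans (lerD h (lexx _)))//.
rewrite normrM -[X in X + _]mul1r -mulrDl addrC mulrC -ler_pdivlMr//.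
exact: ltW.
Unshelve. all: by end_near. Qed.

(* [square_circ U V a b s] is the circulation of [(V, U)] around the boundary
   of the square [a, a + s] x [b, b + s]. *)
Definition square_circ U V a b s : R :=
  seg_int (fun y => U (a + s) y - U a y) b (b + s) -
  seg_int (fun x => V x (b + s) - V x b) a (a + s).

Context (U V : R -> R -> R) (X : R).
(** The shared [p] is the Cauchy-Riemann equation [U_x = V_y], which says that the field [(V, U)]
    has zero curl. *)
Context (UV : forall x y, x < X -> exists p q r,
  frechet_at U x y p q /\ frechet_at V x y r p).

Let cU x a b : x < X -> continuous_on_seg (U x) a b.
Proof.
move=> xX t _; have [p [q [r [/frechet_swap + _]]]] := UV t xX.
exact: frechet_continuousl.
Qed.

Let cV y a b : b < X -> continuous_on_seg (V ^~ y) a b.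
Proof.
move=> bX t /andP[_ tb]; have [p [q [r [_]]]] := UV y (le_lt_trans tb bX).
exact: frechet_continuousl.
Qed.

(** Each inner edge borders two of the four small squares, which traverse it in opposite
    directions. *)
Lemma square_circ_quarter a b s : 0 < s -> a + s + s < X ->
  square_circ U V a b (s + s) =
  square_circ U V a b s + square_circ U V (a + s) b s +
  (square_circ U V a (b + s) s + square_circ U V (a + s) (b + s) s).
Proof.
move=> s0 asX.
have asX' : a + s < X by lra.
have aX : a < X by lra.
rewrite /square_circ !addrA.
rewrite (@seg_int_cat _ (fun y => U (a + s + s) y - U a y) b (b + s) (b + s + s));
  try lra; last first.
  by apply: continuous_on_segB; exact: cU.
rewrite (@seg_int_cat _ (fun x => V x (b + s + s) - V x b) a (a + s) (a + s + s));
  try lra; last first.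
  by apply: continuous_on_segB; exact: cV.
rewrite !seg_intB; try exact: cU; try exact: cV.
ring.
Qed.

(** For the affine approximations at [(x0, y0)] both integrands of the circulation equal [p * s], so
    they cancel; only the first-order error remains. *)
Lemma square_circ_local x0 y0 e : x0 < X -> 0 < e -> exists2 dl, 0 < dl &
  forall a b s, 0 < s -> s < dl -> a <= x0 <= a + s -> b <= y0 <= b + s ->
    a + s < X -> `|square_circ U V a b s| <= e * (s * s).
Proof.
(* Each coordinate is off by at most [s], so a value has error [e / 4 * s], a difference of two
   values [e / 2 * s], and each of the two integrals [e / 2 * s * s]. *)
move=> xX e0; have e8 : 0 < e / 8 by lra.
have [p [q [r [/(_ _ e8)[d1 d10 H1] /(_ _ e8)[d2 d20 H2]]]]] := UV y0 xX.
exists (Num.min d1 d2); first by rewrite lt_min d10.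
move=> a b s s0; rewrite lt_min => /andP[sd1 sd2] /andP[ax xa] /andP[by_ yb] aX.
have nx x : a <= x <= a + s -> `|x - x0| <= s.
  by move=> /andP[h1 h2]; rewrite ler_norml; lra.
have ny y : b <= y <= b + s -> `|y - y0| <= s.
  by move=> /andP[h1 h2]; rewrite ler_norml; lra.
have K1 x y : a <= x <= a + s -> b <= y <= b + s ->
    `|U x y - U x0 y0 - (p * (x - x0) + q * (y - y0))| <= e / 4 * s.
  move=> /nx hx /ny hy; apply: (le_trans (H1 _ _ _ _)); [lra|lra|].
  have -> : e / 4 * s = e / 8 * (s + s) by field.
  by rewrite ler_pM2l// lerD.
have K2 x y : a <= x <= a + s -> b <= y <= b + s ->
    `|V x y - V x0 y0 - (r * (x - x0) + p * (y - y0))| <= e / 4 * s.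
  move=> /nx hx /ny hy; apply: (le_trans (H2 _ _ _ _)); [lra|lra|].
  have -> : e / 4 * s = e / 8 * (s + s) by field.
  by rewrite ler_pM2l// lerD.
have A1 : a <= a <= a + s by lra.
have A2 : a <= a + s <= a + s by lra.
have B1 : b <= b <= b + s by lra.
have B2 : b <= b + s <= b + s by lra.
have bs : b <= b + s by lra.
have as_ : a <= a + s by lra.
have aX' : a < X by lra.
have cDU : continuous_on_seg (fun y => U (a + s) y - U a y) b (b + s).
  by apply: continuous_on_segB; exact: cU.
have cDV : continuous_on_seg (fun x => V x (b + s) - V x b) a (a + s).
  by apply: continuous_on_segB; exact: cV.
have := seg_int_dist (k := p * s) (e := e / 2 * s) bs cDU.
have := seg_int_dist (k := p * s) (e := e / 2 * s) as_ cDV.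
rewrite /square_circ.
set I1 := seg_int _ _ _; set I2 := seg_int _ _ _ => L2 L1.
have {}L1 : `|I2 - p * s * (b + s - b)| <= e / 2 * s * (b + s - b).
  apply: L1 => t bt; have := K1 _ _ A1 bt; have := K1 _ _ A2 bt.
  rewrite !ler_norml => /andP[h1 h2] /andP[h3 h4]; apply/andP; split; lra.
have {}L2 : `|I1 - p * s * (a + s - a)| <= e / 2 * s * (a + s - a).
  apply: L2 => t at_; have := K2 _ _ at_ B1; have := K2 _ _ at_ B2.
  rewrite !ler_norml => /andP[h1 h2] /andP[h3 h4]; apply/andP; split; lra.
move: L1 L2.
have -> : b + s - b = s by ring.
have -> : a + s - a = s by ring.
rewrite !ler_norml => /andP[h1 h2] /andP[h3 h4]; apply/andP; split; lra.
Qed.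

(** Otherwise bisection gives nested squares whose circulation stays above a fixed multiple of their
    area; at their common point this contradicts [square_circ_local]. *)
Lemma square_circ_eq0 a0 b0 s0 : 0 < s0 -> a0 + s0 < X ->
  square_circ U V a0 b0 s0 = 0.
Proof.
move=> s00 aX; apply/eqP; apply: contraT => E0.
(* Half the initial ratio of circulation to area, so that [bad] holds strictly at the start. *)
pose eta := `|square_circ U V a0 b0 s0| / (2 * (s0 * s0)).
have eta0 : 0 < eta by rewrite divr_gt0 ?normr_gt0// !mulr_gt0.
pose bad (c : R * R) s := eta * (s * s) < `|square_circ U V c.1 c.2 s|.
have bad0 : bad (a0, b0) s0.
  rewrite /bad/= /eta; have N0 : 0 < `|square_circ U V a0 b0 s0| by rewrite normr_gt0.
  have S0 : 0 < s0 * s0 by rewrite mulr_gt0.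
  have -> (N : R) : N / (2 * (s0 * s0)) * (s0 * s0) = N / 2 by field; rewrite gt_eqF.
  by lra.
(* The premises stand under the existential so that [choice] yields a total successor function
   [nxt]. *)
have step (c : R * R) s : exists c' : R * R, 0 < s -> c.1 + s + s < X -> bad c (s + s) ->
    [/\ c.1 <= c'.1 <= c.1 + s, c.2 <= c'.2 <= c.2 + s & bad c' s].
  case: c => a b /=.
  have [bc|nbad] := pselect (bad (a, b) (s + s)); last by exists (a, b).
  have [c1|n1] := pselect (bad (a, b) s).
    by exists (a, b) => s1 _ _ /=; split => //; lra.
  have [c2|n2] := pselect (bad (a + s, b) s).
    by exists (a + s, b) => s1 _ _ /=; split => //; lra.
  have [c3|n3] := pselect (bad (a, b + s) s).
    by exists (a, b + s) => s1 _ _ /=; split => //; lra.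
  have [c4|n4] := pselect (bad (a + s, b + s) s).
    by exists (a + s, b + s) => s1 _ _ /=; split => //; lra.
  (* If no quarter is bad, the four bounds add up to the bound for the whole square, against
     [bc]. *)
  exists (a, b) => s1 asX _; exfalso.
  move: n1 n2 n3 n4 bc; rewrite /bad/= => /negP + /negP + /negP + /negP.
  rewrite -!leNgt square_circ_quarter// => n1 n2 n3 n4; apply/negP; rewrite -leNgt.
  rewrite !(le_trans (ler_normD _ _))//.
  apply: (le_trans (lerD (ler_normD _ _) (ler_normD _ _))).
  have -> : eta * ((s + s) * (s + s)) =
    eta * (s * s) + eta * (s * s) + (eta * (s * s) + eta * (s * s)) by ring.
  by rewrite !lerD.
have [nxt nxtP] := choice (fun cs : (R * R) * R => step cs.1 cs.2).
pose sz n := s0 / 2 ^+ n.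
have szS n : sz n.+1 + sz n.+1 = sz n.
  by rewrite /sz exprS; field; rewrite expf_neq0.
have sz0 n : 0 < sz n by rewrite /sz divr_gt0// exprn_gt0.
pose sq := fix sq n := if n is m.+1 then nxt (sq m, sz m.+1) else (a0, b0).
have sqP n : [/\ (sq n).1 + sz n <= a0 + s0 & bad (sq n) (sz n)].
  elim: n => [|n [IH1 IH2]]; first by rewrite /sz expr0 divr1/=.
  have /= := nxtP (sq n, sz n.+1) (sz0 _).
  rewrite -addrA szS => /(_ (le_lt_trans IH1 aX) IH2) [h1 h2 h3].
  by split => //=; rewrite (le_trans _ IH1)// -(szS n) addrA; have := sz0 n.+1; lra.
have sqS n : (sq n).1 <= (sq n.+1).1 <= (sq n).1 + sz n.+1 /\
             (sq n).2 <= (sq n.+1).2 <= (sq n).2 + sz n.+1.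
  have [IH1 IH2] := sqP n.
  have /= := nxtP (sq n, sz n.+1) (sz0 _).
  by rewrite -addrA szS => /(_ (le_lt_trans IH1 aX) IH2) [h1 h2 h3].
(* Nested intervals in one coordinate: left ends increase, right ends decrease, and the supremum of
   the left ends lies in all of them. *)
have nested (u : R ^nat) : (forall n, u n <= u n.+1 <= u n + sz n.+1) ->
    exists l, forall n, u n <= l <= u n + sz n.
  move=> hu.
  have inc n m : u n <= u (n + m)%N.
    elim: m => [|m IH]; first by rewrite addn0.
    by rewrite addnS (le_trans IH)//; case/andP: (hu (n + m)%N).
  have dec n m : u (n + m)%N + sz (n + m)%N <= u n + sz n.
    elim: m => [|m IH]; first by rewrite addn0.
    rewrite addnS (le_trans _ IH)//; case/andP: (hu (n + m)%N) => _.
    by rewrite -(szS (n + m)%N); lra.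
  have le_ub n m : u n <= u m + sz m.
    have := inc n m; have := dec m n; rewrite addnC; have := sz0 (n + m)%N; lra.
  exists (sup (range u)) => n; apply/andP; split.
  - apply: ub_le_sup; last by exists n.
    by exists (u 0%N + sz 0%N) => _ [m _ <-]; exact: le_ub.
  - by apply: ge_sup; [exists (u 0%N), 0%N|move=> _ [m _ <-]; exact: le_ub].
have [x0 hx0] := nested (fun n => (sq n).1) (fun n => (sqS n).1).
have [y0 hy0] := nested (fun n => (sq n).2) (fun n => (sqS n).2).
have x0X : x0 < X.
  have := hx0 0%N; rewrite /sz expr0 divr1/= => /andP[_ h]; exact: le_lt_trans aX.
have [dl dl0 H] := square_circ_local y0 x0X eta0.
have [n ndl] : exists n, sz n < dl.
  (* This index exceeds [s0 / dl], and [2 ^ n] exceeds [n]. *)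
  exists (Num.truncn (s0 / dl)).+1.
  rewrite /sz ltr_pdivrMr ?exprn_gt0// mulrC -ltr_pdivrMr//.
  rewrite (lt_le_trans (truncnS_gt _))// -natrX ler_nat.
  by rewrite ltnW// ltn_expl.
have [le_a bd] := sqP n.
have := H (sq n).1 (sq n).2 (sz n) (sz0 n) ndl (hx0 n) (hy0 n) (le_lt_trans le_a aX).
by rewrite leNgt => /negP[].
Qed.

End goursat.

(** * Real-valued modulus, real and imaginary parts *)

Section modulus_theory.
Context {R : realType}.
Implicit Types (z w : Cplx R) (x y : R).

Definition cpx x y : Cplx R := Complex x y.

Lemma cpxE z : z = cpx (complex.Re z) (complex.Im z).
Proof. by case: z. Qed.

Lemma norm_modulus z : `|z| = real_to_C (modulus z).
Proof. by rewrite /modulus normc_def. Qed.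

Lemma modulusE z : modulus z = Num.sqrt (complex.Re z ^+ 2 + complex.Im z ^+ 2).
Proof. by rewrite /modulus normc_def. Qed.

Lemma real_to_C_le x y : (real_to_C x <= real_to_C y) = (x <= y).
Proof. exact: lecR. Qed.

Lemma real_to_C_lt x y : (real_to_C x < real_to_C y) = (x < y).
Proof. exact: ltcR. Qed.

Lemma modulus_ge0 z : 0 <= modulus z.
Proof. by rewrite modulusE sqrtr_ge0. Qed.

Lemma modulusM z w : modulus (z * w) = modulus z * modulus w.
Proof.
by rewrite [LHS]/modulus normrM !norm_modulus /real_to_C -rmorphM.
Qed.

Lemma modulus0 : modulus (0 : Cplx R) = 0.
Proof. by rewrite /modulus normr0. Qed.

Lemma modulus1 : modulus (1 : Cplx R) = 1.
Proof. by rewrite /modulus normr1. Qed.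

Lemma modulus_eq0 z : (modulus z == 0) = (z == 0).
Proof. by rewrite -[RHS]normr_eq0 norm_modulus /real_to_C (inj_eq (@complexI R) _ 0). Qed.

Lemma modulusX z n : modulus (z ^+ n) = modulus z ^+ n.
Proof. by elim: n => [|n IH]; rewrite ?expr0 ?modulus1// !exprS modulusM IH. Qed.

Lemma modulusD z w : modulus (z + w) <= modulus z + modulus w.
Proof.
rewrite -real_to_C_le -norm_modulus /real_to_C rmorphD/=.
by rewrite -[(_)%:C%C]/(real_to_C _) -!norm_modulus; exact: ler_normD.
Qed.

Lemma modulusN z : modulus (- z) = modulus z.
Proof. by rewrite /modulus normrN. Qed.

Lemma modulusB z w : modulus (z - w) = modulus (w - z).
Proof. by rewrite /modulus distrC. Qed.

Lemma modulusV z : modulus z^-1 = (modulus z)^-1.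
Proof.
by rewrite [LHS]/modulus normfV norm_modulus /real_to_C -fmorphV.
Qed.

Lemma modulus_real x : modulus (real_to_C x) = `|x|.
Proof. by rewrite modulusE/= expr0n addr0 sqrtr_sqr. Qed.

Lemma Re_le_modulus z : `|complex.Re z| <= modulus z.
Proof. by have := normc_ge_Re z; rewrite [X in _ <= X -> _]norm_modulus lecR. Qed.

Lemma sqr_modulus z : modulus z ^+ 2 = complex.Re z ^+ 2 + complex.Im z ^+ 2.
Proof. by rewrite modulusE sqr_sqrtr// addr_ge0// sqr_ge0. Qed.

Lemma Im_le_modulus z : `|complex.Im z| <= modulus z.
Proof.
by rewrite modulusE -sqrtr_sqr ler_wsqrtr// lerDr sqr_ge0.
Qed.

Lemma modulus_cpx x y : modulus (cpx x y) <= `|x| + `|y|.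
Proof.
have -> : cpx x y = real_to_C x + 'i%C * real_to_C y by rewrite [LHS]complexE.
rewrite (le_trans (modulusD _ _))// lerD// ?modulus_real// modulusM.
rewrite modulus_real [X in X * _](_ : _ = 1) ?mul1r//.
by rewrite modulusE/= expr0n add0r expr1n sqrtr1.
Qed.

Lemma Re_add z w : complex.Re (z + w) = complex.Re z + complex.Re w.
Proof. by case: z; case: w. Qed.

Lemma Im_add z w : complex.Im (z + w) = complex.Im z + complex.Im w.
Proof. by case: z; case: w. Qed.

Lemma Re_opp z : complex.Re (- z) = - complex.Re z.
Proof. by case: z. Qed.

Lemma Im_opp z : complex.Im (- z) = - complex.Im z.
Proof. by case: z. Qed.

Lemma Re_mul z w :
  complex.Re (z * w) = complex.Re z * complex.Re w - complex.Im z * complex.Im w.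
Proof. by case: z; case: w. Qed.

Lemma Im_mul z w :
  complex.Im (z * w) = complex.Re z * complex.Im w + complex.Im z * complex.Re w.
Proof. by case: z => a b; case: w. Qed.

End modulus_theory.

(** Stated over any [numFieldType] because it serves both complex functions and the real [expR],
    [cos] and [sin]. *)
Lemma derivable_expansion (K : numFieldType) (f : K -> K) (z : K) :
  derivable f z 1 -> forall e, 0 < e -> exists2 dl, 0 < dl & forall w,
    `|w - z| < dl -> `|f w - f z - 'D_1 f z * (w - z)| <= e * `|w - z|.
Proof.
move=> df e e0.
have /cvgrPdist_le /(_ e e0) [dl /= dl0 H] :
    (fun h => h^-1 *: (f (h *: 1 + z) - f z)) @ 0^' --> 'D_1 f z := df.
exists dl => // w wz; have [->|wz0] := eqVneq w z.
  by rewrite !subrr mulr0 subrr normr0 mulr0.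
have := H (w - z).
rewrite /ball_/= sub0r normrN => /(_ wz).
rewrite subr_eq0 => /(_ wz0).
rewrite [_ *: 1]mulr1 subrK => h.
have wz0' : w - z != 0 by rewrite subr_eq0.
have -> : f w - f z - 'D_1 f z * (w - z) =
    - (('D_1 f z - (w - z)^-1 *: (f w - f z)) * (w - z)).
  rewrite mulrBl -[_ *: _]/(_ * _) mulrAC mulVf// mul1r opprB //.
by rewrite normrN normrM ler_wpM2r.
Qed.

(** * Logarithmic polar coordinates and the mean over circles *)

Section log_polar.
Context {R : realType}.
Implicit Types (z w l : Cplx R) (x y : R) (f : Cplx R -> Cplx R).

Lemma complex_expansion f z : derivable f z 1 ->
  exists l, forall e : R, 0 < e -> exists2 dl : R, 0 < dl & forall w,
    modulus (w - z) < dl ->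
    modulus (f w - f z - l * (w - z)) <= e * modulus (w - z).
Proof.
move=> /derivable_expansion H; exists ('D_1 f z) => e e0.
have [|dl dl0 {}H] := H (real_to_C e); first by rewrite (real_to_C_lt 0).
(* In the order of [R[i]] a positive element is real, so a real radius can be read off. *)
have dlE : dl = real_to_C (complex.Re dl).
  by rewrite /real_to_C RRe_real// gtr0_real.
exists (complex.Re dl); first by move: dl0; rewrite dlE (real_to_C_lt 0).
move=> w wz; have := H w; rewrite dlE !norm_modulus real_to_C_lt => /(_ wz).
by rewrite -[_ * real_to_C _]rmorphM/= => h; rewrite -real_to_C_le.
Qed.

(** The complex exponential of [x + iy], in real coordinates. *)
Definition cexp x y : Cplx R := cpx (expR x * cos y) (expR x * sin y).

Lemma cexpB x y x0 y0 : cexp x y = cexp x0 y0 * cexp (x - x0) (y - y0).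
Proof.
have -> : x = x0 + (x - x0) by ring.
have -> : y = y0 + (y - y0) by ring.
rewrite ![_ + (_ - _) - _]addrC !addKr; set h := x - x0; set k := y - y0.
rewrite /cexp expRD sinD cosD; apply/eqP; rewrite eq_complex/=.
by apply/andP; split; apply/eqP; ring.
Qed.

Lemma modulus_cexp x y : modulus (cexp x y) = expR x.
Proof.
rewrite modulusE/= !exprMn -mulrDr cos2Dsin2 mulr1 sqrtr_sqr ger0_norm//.
Qed.

Lemma cexp_expansion0 e : 0 < e -> exists2 dl, 0 < dl & forall h k,
  `|h| < dl -> `|k| < dl ->
  modulus (cexp h k - 1 - cpx h k) <= e * (`|h| + `|k|).
Proof.
(* The slash separates the generalized variable from the assumption, which is [e <= 1]; in general
   [e] is replaced by its minimum with 1. *)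
wlog e1 : e / e <= 1 => [H e0|e0].
  have [||dl dl0 Hdl] := H (Num.min e 1).
  - by rewrite ge_min lexx orbT.
  - by rewrite lt_min e0 ltr01.
  exists dl => // h k hdl kdl; rewrite (le_trans (Hdl _ _ hdl kdl))//.
  by rewrite ler_wpM2r ?addr_ge0// ge_min lexx.
have e4 : 0 < e / 4 by lra.
have expand (g : R -> R) (d : R) : is_derive (0 : R) 1 g d -> exists2 dl, 0 < dl & forall h,
    `|h| < dl -> `|g h - g 0 - d * h| <= e / 4 * `|h|.
  move=> dg; have /derivable_expansion/(_ _ e4)[dl dl0 H] : derivable g 0 1.
    exact: ex_derive.
  exists dl => // h; rewrite -{1}(subr0 h) => /H; rewrite derive_val.
  by rewrite !subr0.
have [d1 d10 H1] := expand _ _ (is_derive_expR 0).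
have [d2 d20 H2] := expand _ _ (is_derive_cos 0).
have [d3 d30 H3] := expand _ _ (is_derive_sin 0).
(* The bound [e / 16] on [h] turns the cross term [4 * |h| * |k|], which bounds
   [(expR h - 1) * sin k], into [e / 4 * |k|]. *)
exists (Num.min (Num.min d1 d2) (Num.min d3 (e / 16))).
  by rewrite !lt_min d10 d20 d30/= divr_gt0.
move=> h k; rewrite !lt_min => /andP[/andP[h1 h2] /andP[h3 h4]].
move=> /andP[/andP[k1 k2] /andP[k3 k4]].
have {}H1 := H1 h h1; have {}H2 := H2 k k2; have {}H3 := H3 k k3.
move: H1 H2 H3; rewrite expR0 mul1r cos0 sin0 oppr0 mul0r oppr0 !addr0 mul1r => H1 H2 H3.
have cosk : `|cos k| <= 1 by rewrite ler_norml cos_geN1 cos_le1.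
have eh : `|expR h - 1| <= 2 * `|h|.
  have -> : expR h - 1 = (expR h - 1 - h) + h by ring.
  rewrite (le_trans (ler_normD _ _))// (le_trans (lerD H1 (lexx _)))//.
  have := normr_ge0 h; nra.
have sk : `|sin k| <= 2 * `|k|.
  have -> : sin k = (sin k - k) + k by ring.
  rewrite (le_trans (ler_normD _ _))// (le_trans (lerD H3 (lexx _)))//.
  have := normr_ge0 k; nra.
have -> : cexp h k - 1 - cpx h k =
  cpx ((expR h - 1 - h) * cos k + (1 + h) * (cos k - 1))
      ((expR h - 1) * sin k + (sin k - k)).
  apply/eqP; rewrite eq_complex/=.
  by apply/andP; split; apply/eqP; ring.
rewrite (le_trans (modulus_cpx _ _))//.
have h1' : `|1 + h| <= 2.
  by rewrite (le_trans (ler_normD _ _))// normr1; lra.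
have T1 : `|(expR h - 1 - h) * cos k| <= e / 4 * `|h|.
  rewrite normrM; have := normr_ge0 (expR h - 1 - h).
  by move=> n0; rewrite (le_trans _ H1)// ler_piMr.
have T2 : `|(1 + h) * (cos k - 1)| <= e / 4 * `|k| * 2.
  by rewrite normrM mulrC ler_pM.
have T3 : `|(expR h - 1) * sin k| <= e / 4 * `|k|.
  rewrite normrM (le_trans (ler_pM _ _ eh sk))//.
  have -> : 2 * `|h| * (2 * `|k|) = (4 * `|h|) * `|k| by ring.
  by rewrite ler_wpM2r//; lra.
have := ler_normD ((expR h - 1 - h) * cos k) ((1 + h) * (cos k - 1)).
have := ler_normD ((expR h - 1) * sin k) (sin k - k).
have := mulr_ge0 (ltW e0) (normr_ge0 h); lra.
Qed.

Lemma cexp_expansion x0 y0 e : 0 < e -> exists2 dl, 0 < dl & forall x y,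
  `|x - x0| < dl -> `|y - y0| < dl ->
  modulus (cexp x y - cexp x0 y0 - cexp x0 y0 * cpx (x - x0) (y - y0)) <=
  e * (`|x - x0| + `|y - y0|).
Proof.
move=> e0; have x00 := expR_gt0 x0.
have [|dl dl0 H] := @cexp_expansion0 (e / expR x0); first by rewrite divr_gt0.
exists dl => // x y hx hy; rewrite (cexpB x y x0 y0).
have -> (a b c : Cplx R) : a * b - a - a * c = a * (b - 1 - c) by ring.
rewrite modulusM modulus_cexp mulrC -ler_pdivlMr// mulrAC; exact: H.
Qed.

(** The chain rule: the derivative is that of [f] times [cexp x0 y0], the exponential being its own
    derivative. *)
Lemma log_polar_expansion f z0 x0 y0 : derivable f (z0 + cexp x0 y0) 1 ->
  exists l, forall e, 0 < e -> exists2 dl, 0 < dl & forall x y,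
  `|x - x0| < dl -> `|y - y0| < dl ->
  modulus (f (z0 + cexp x y) - f (z0 + cexp x0 y0) - l * cpx (x - x0) (y - y0))
  <= e * (`|x - x0| + `|y - y0|).
Proof.
move=> /complex_expansion[l Hf]; set c := cexp x0 y0 in Hf *.
exists (l * c) => e e0.
(* [M] is a Lipschitz constant of [cexp] near [(x0, y0)], the 1 absorbing its first-order error.
   Half of [e] goes to the expansion of [f], half to that of [cexp]. *)
pose M := modulus c + 1.
have M0 : 0 < M by rewrite ltr_wpDl// modulus_ge0.
have [|d1 d10 {}Hf] := Hf (e / 2 / M); first by rewrite !divr_gt0.
pose N := modulus l + 1.
have N0 : 0 < N by rewrite ltr_wpDl// modulus_ge0.
have [|d2 d20 H2] := @cexp_expansion x0 y0 (Num.min 1 (e / 2 / N)).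
  by rewrite lt_min ltr01 !divr_gt0.
pose d3 := d1 / (2 * M).
have d30 : 0 < d3 by rewrite divr_gt0// mulr_gt0.
exists (Num.min d2 d3) => [|x y]; first by rewrite lt_min d20.
rewrite !lt_min => /andP[x2 x3] /andP[y2 y3].
have := H2 x y x2 y2; rewrite -/c.
set D := `|_| + `|_|; set h := cpx _ _ => Hc.
have D0 : 0 <= D by rewrite addr_ge0.
have hD : modulus h <= D by exact: modulus_cpx.
set w := z0 + cexp x y.
have wE : w - (z0 + c) = cexp x y - c by rewrite /w; ring.
have wM : modulus (w - (z0 + c)) <= M * D.
  rewrite wE; have -> : cexp x y - c = (cexp x y - c - c * h) + c * h by ring.
  rewrite (le_trans (modulusD _ _))// modulusM mulrDl addrC mul1r lerD//.
    by rewrite ler_wpM2l// modulus_ge0.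
  by rewrite (le_trans Hc)// -[leRHS]mul1r ler_wpM2r// ge_min lexx.
have wd1 : modulus (w - (z0 + c)) < d1.
  rewrite (le_lt_trans wM)// mulrC -ltr_pdivlMr//.
  have -> : d1 / M = d3 + d3 by rewrite /d3; field; rewrite gt_eqF.
  by rewrite ltrD.
have := Hf w wd1.
have -> : f w - f (z0 + c) - l * c * h =
   (f w - f (z0 + c) - l * (w - (z0 + c))) + l * (cexp x y - c - c * h).
  by rewrite wE; ring.
move=> H1; rewrite (le_trans (modulusD _ _))//.
have -> : e * D = e / 2 / M * (M * D) + N * (e / 2 / N * D).
  by field; rewrite !gt_eqF.
rewrite lerD//.
  by rewrite (le_trans H1)// ler_wpM2l// !divr_ge0// ltW.
rewrite modulusM ler_pM ?modulus_ge0//; first by rewrite lerDl.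
by rewrite (le_trans Hc)// ler_wpM2r// ge_min lexx orbT.
Qed.

(** Multiplication by [l] sends [(x, y)] to [(Re l x - Im l y, Im l x + Re l y)], whence the common
    coefficient [p = Re l]. *)
Lemma log_polar_frechet f z0 x0 y0 : derivable f (z0 + cexp x0 y0) 1 ->
  exists p q r,
    frechet_at (fun x y => complex.Re (f (z0 + cexp x y))) x0 y0 p q /\
    frechet_at (fun x y => complex.Im (f (z0 + cexp x y))) x0 y0 r p.
Proof.
move=> /log_polar_expansion[l H].
exists (complex.Re l), (- complex.Im l), (complex.Im l).
split=> e e0; have [dl dl0 {}H] := H e e0; exists dl => // x y hx hy;
  rewrite (le_trans _ (H x y hx hy))//.
- rewrite (le_trans _ (Re_le_modulus _))// !(Re_add, Re_opp) Re_mul/= le_eqVlt; apply/orP.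
  by left; apply/eqP; congr `|_|; ring.
- rewrite (le_trans _ (Im_le_modulus _))// !(Im_add, Im_opp) Im_mul/= le_eqVlt; apply/orP.
  by left; apply/eqP; congr `|_|; ring.
Qed.

(* The mean of [complex.Re f] over the circle of radius [expR x] centred at [z0]
   does not depend on [x], by Goursat in logarithmic polar coordinates, and tends
   to [complex.Re (f z0)] as [x] tends to minus infinity. *)
Lemma no_strict_max f z0 rho eps : 0 < rho -> 0 < eps ->
  {for z0, continuous f} ->
  (forall z, 0 < modulus (z - z0) < rho -> derivable f z 1) ->
  (forall z, modulus (z - z0) < rho ->
     complex.Re (f z) <= complex.Re (f z0) - eps * modulus (z - z0) ^+ 2) ->
  False.
Proof.
move=> rho0 eps0 cf df fmax.
pose T : R := pi *+ 2.
have T0 : 0 < T by rewrite mulrn_wgt0// pi_gt0.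
pose U x y := complex.Re (f (z0 + cexp x y)).
pose V x y := complex.Im (f (z0 + cexp x y)).
have UV x y : x < ln rho -> exists p q r,
    frechet_at U x y p q /\ frechet_at V x y r p.
  move=> xX; apply: log_polar_frechet; apply: df.
  rewrite addrC addKr modulus_cexp expR_gt0/=.
  by rewrite -[ltRHS]lnK// ltr_expR.
have cU x a b : x < ln rho -> continuous_on_seg (U x) a b.
  move=> xX t _; have [p [q [r [/frechet_swap + _]]]] := UV x t xX.
  exact: frechet_continuousl.
pose m x := seg_int (U x) 0 T.
(* Goursat on a square of side [T]: the horizontal edges cancel because [V] has period [T] in [y].
   Working with squares makes the shift in [x] equal to [T] too; [mk] iterates it to the left. *)
have mT x : x + T < ln rho -> m (x + T) = m x.
  move=> xT; have xX : x < ln rho by lra.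
  have := square_circ_eq0 UV 0 T0 xT; rewrite /square_circ add0r.
  rewrite seg_intB; [|exact: cU..].
  have -> : (fun x => V x T - V x 0) = cst 0.
    apply/funext => t; rewrite /V /cexp -[T]add0r cosD2pi sinD2pi subrr //.
  rewrite seg_int_cst; last lra.
  by rewrite mul0r subr0 => /eqP; rewrite subr_eq0 => /eqP.
pose x1 := ln rho - 1.
have mk k : m (x1 - T *+ k) = m x1.
  elim: k => [|k <-]; first by rewrite mulr0n subr0.
  rewrite -(mT (x1 - T *+ k.+1)).
    by congr m; rewrite mulrS; ring.
  have : 0 <= T *+ k by rewrite mulrn_wge0// ltW.
  by rewrite mulrS /x1; lra.
(* On the circle of radius [expR x1] the real part is at most [u0 - gap], while on small circles
   continuity keeps it above [u0 - gap / 2]; equal means make this absurd. *)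
pose u0 := complex.Re (f z0); pose gap := eps * expR x1 ^+ 2.
have gap0 : 0 < gap by rewrite mulr_gt0// exprn_gt0// expR_gt0.
have mx1 : m x1 <= (u0 - gap) * T.
  rewrite -[X in _ * X]subr0; apply: seg_int_le; [exact: ltW|apply: cU; rewrite /x1; lra|].
  move=> t _; have := fmax (z0 + cexp x1 t).
  rewrite addrC addKr modulus_cexp; apply.
  by rewrite -[ltRHS]lnK// ltr_expR /x1; lra.
have [dl dl0 Hdl] : exists2 dl, 0 < dl & forall z, modulus (z - z0) < dl ->
    u0 - gap / 2 <= complex.Re (f z).
  move/cvgrPdist_le : cf => /(_ (real_to_C (gap / 2))).
  rewrite (real_to_C_lt 0) divr_gt0// => /(_ isT)[d /= d0 H].
  have dE : d = real_to_C (complex.Re d) by rewrite /real_to_C RRe_real// gtr0_real.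
  exists (complex.Re d); first by move: d0; rewrite dE (real_to_C_lt 0).
  move=> z hz; have /= := H z.
  rewrite distrC dE !norm_modulus real_to_C_lt => /(_ hz).
  rewrite real_to_C_le => /(le_trans (Re_le_modulus _)).
  by rewrite Re_add Re_opp ler_norml /u0 => /andP[h1 h2]; lra.
have [k hk] : exists k : nat, x1 - T *+ k < ln dl.
  exists (Num.truncn (`|x1 - ln dl| / T)).+1.
  have := truncnS_gt (`|x1 - ln dl| / T).
  rewrite ltr_pdivrMr// mulr_natl => h; have := ler_norm (x1 - ln dl); lra.
have xk : x1 - T *+ k < ln rho.
  have : 0 <= T *+ k by rewrite mulrn_wge0// ltW.
  by rewrite /x1; lra.
have : (u0 - gap / 2) * (T - 0) <= m (x1 - T *+ k).
  apply: seg_int_ge; [exact: ltW|exact: cU|].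
  move=> t _; apply: Hdl; rewrite addrC addKr modulus_cexp.
  by rewrite -[ltRHS]lnK// ltr_expR.
rewrite mk subr0 => h; have := le_trans h mx1.
rewrite ler_pM2r//; lra.
Qed.

End log_polar.

(** * The maximum principle *)

Section maximum_principle.
Context {R : realType}.
Implicit Types (z w : Cplx R) (f : Cplx R -> Cplx R).

Lemma nbhs_modulusP z (P : set (Cplx R)) : nbhs z P <->
  exists2 e : R, 0 < e & forall w, modulus (w - z) < e -> P w.
Proof.
split=> [/nbhs_ballP[d /= d0 H]|[e e0 H]].
  have dE : d = real_to_C (complex.Re d) by rewrite /real_to_C RRe_real// gtr0_real.
  exists (complex.Re d); first by move: d0; rewrite dE (real_to_C_lt 0).
  move=> w wz; apply: H; rewrite /ball/= distrC dE norm_modulus real_to_C_lt//.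
apply/nbhs_ballP; exists (real_to_C e) => /=; first by rewrite (real_to_C_lt 0).
move=> w; rewrite /ball/= distrC norm_modulus real_to_C_lt; exact: H.
Qed.

Lemma modulus_lip z w : `|modulus z - modulus w| <= modulus (z - w).
Proof.
rewrite ler_norml; have := modulusD (z - w) w; rewrite subrK.
by have := modulusD (w - z) z; rewrite subrK modulusB; lra.
Qed.

Lemma modulus_lip_continuous (g : Cplx R -> R) :
  (forall z w, `|g z - g w| <= modulus (z - w)) -> continuous g.
Proof.
move=> lip z A /nbhs_ballP[e /= e0 H]; apply/nbhs_modulusP; exists e => // w wz.
by apply: H; rewrite /ball/= (le_lt_trans (lip _ _))// modulusB.
Qed.

Lemma continuous_modulus : continuous (@modulus R).
Proof. exact/modulus_lip_continuous/modulus_lip. Qed.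

Lemma continuous_Re : continuous (@complex.Re R : Cplx R -> R).
Proof.
apply: modulus_lip_continuous => z w.
by rewrite -Re_opp -Re_add; exact: Re_le_modulus.
Qed.

(** The disc is closed and lies in the continuous image of the compact square of side [2 * r]. *)
Lemma compact_closed_disc (r : R) : compact [set z : Cplx R | modulus z <= r].
Proof.
pose sq : set (R * R) := `[- r, r]%classic `*` `[- r, r]%classic.
pose P (p : R * R) : Cplx R := cpx p.1 p.2.
have cP : continuous P.
  move=> p A /nbhs_modulusP[d d0 H].
  have d2 : 0 < d / 2 by lra.
  suff : \forall q \near p, A (P q) by [].
  near=> q; apply: H; rewrite modulusB.
  have -> : P p - P q = cpx (p.1 - q.1) (p.2 - q.2) by [].
  have h1 : `|p.1 - q.1| < d / 2.
    by near: q; apply: (@cvgr_dist_lt _ R) => //; exact: cvg_fst.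
  have h2 : `|p.2 - q.2| < d / 2.
    by near: q; apply: (@cvgr_dist_lt _ R) => //; exact: cvg_snd.
  by rewrite (le_lt_trans (modulus_cpx _ _))//; lra.
apply: (@subclosed_compact _ _ (P @` sq)).
- have -> : [set z : Cplx R | modulus z <= r] = (@modulus R) @^-1` [set x | x <= r] by [].
  apply: closed_comp; last exact: closed_le.
  by move=> z _; exact: continuous_modulus.
- apply: continuous_compact; first exact: continuous_subspaceT.
  by apply: compact_setX; exact: segment_compact.
- move=> z /= zr; exists (complex.Re z, complex.Im z); last by rewrite /P -cpxE.
  split => /=; rewrite in_itv/= -ler_norml.
    by rewrite (le_trans (Re_le_modulus _)).
  by rewrite (le_trans (Im_le_modulus _)).
Unshelve. all: by end_near. Qed.

(** If the bound failed, [Re f + eps |z|^2] would have an interior maximum; adding a linear term to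
    [f] there produces the situation excluded by [no_strict_max]. The point 0 is exempt from
    differentiability with a view to the quotients [psi_i], which are built to be continuous
    there. *)
Lemma maximum_principle f (r alpha : R) :
  (forall z, modulus z <= r -> {for z, continuous f}) ->
  (forall z, z != 0 -> modulus z < r -> derivable f z 1) ->
  (forall z, modulus z = r -> complex.Re (f z) <= alpha) ->
  forall z, modulus z <= r -> complex.Re (f z) <= alpha.
Proof.
move=> cf df fr z1 z1r; rewrite leNgt; apply/negP => z1alpha.
have r0 : 0 <= r by rewrite (le_trans (modulus_ge0 z1)).
(* Small enough that on the circle the added [eps * r ^+ 2] stays below the excess at [z1]; the 1 in
   the denominator covers [r = 0]. *)
pose eps := (complex.Re (f z1) - alpha) / (2 * (r ^+ 2 + 1)).
have r2 : 0 < r ^+ 2 + 1 by rewrite ltr_wpDl// sqr_ge0.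
have eps0 : 0 < eps by rewrite divr_gt0 ?subr_gt0// mulr_gt0.
have epsr : eps * r ^+ 2 < complex.Re (f z1) - alpha.
  rewrite /eps mulrAC ltr_pdivrMr ?mulr_gt0// ltr_pM2l ?subr_gt0//.
  by have := sqr_ge0 r; lra.
pose g z := complex.Re (f z) + eps * modulus z ^+ 2.
have [z0] : exists2 z0, z0 \in [set z : Cplx R | modulus z <= r] &
    forall z, z \in [set z : Cplx R | modulus z <= r] -> g z <= g z0.
  apply: compact_EVT_max; [by exists z1|exact: compact_closed_disc|].
  apply: continuous_in_subspaceT => z; rewrite inE/= => zr.
  apply: (@continuousD R R _ (fun z => complex.Re (f z)) (fun z => eps * modulus z ^+ 2)).
    apply: (@continuous_comp _ _ _ f (@complex.Re R)); [exact: cf|exact: continuous_Re].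
  apply: (@continuousM R _ (cst eps) (fun z => modulus z ^+ 2)); first exact: cst_continuous.
  apply: (@continuous_comp _ _ _ (@modulus R) (fun x => x ^+ 2)).
    exact: continuous_modulus.
  exact: exprn_continuous.
rewrite inE/= => z0r z0max.
have gz1 : g z1 <= g z0 by apply: z0max; rewrite inE.
have {z0r}z0r : modulus z0 < r.
  rewrite lt_neqAle z0r andbT; apply/eqP => z0r'.
  have := fr z0 z0r'; move: gz1; rewrite /g z0r'.
  by have := mulr_ge0 (ltW eps0) (sqr_ge0 (modulus z1)); lra.
(* The punctured disc of radius [rho] about [z0] must stay inside the large disc and avoid 0. *)
pose rho := if z0 == 0 then r else Num.min (modulus z0) (r - modulus z0).
have rho_r : rho <= r - modulus z0.
  rewrite /rho; case: eqP => [->|_]; first by rewrite modulus0 subr0.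
  by rewrite ge_min lexx orbT.
have rho0 : 0 < rho.
  rewrite /rho; case: eqP z0r => [->|/eqP z00] z0r; first by rewrite modulus0 in z0r.
  by rewrite lt_min subr_gt0 z0r andbT lt_neqAle modulus_ge0 eq_sym modulus_eq0 z00.
have near_z0 z : modulus (z - z0) < rho -> modulus z < r.
  move=> h; rewrite -(subrK z0 z) (le_lt_trans (modulusD _ _))//; lra.
have near_n0 z : 0 < modulus (z - z0) < rho -> z != 0.
  move=> /andP[h1 h2]; apply/eqP => z00; move: h1 h2; rewrite z00 modulusB subr0 /rho.
  case: eqP => [->|_]; first by rewrite modulus0 ltxx.
  by rewrite lt_min ltxx.
(* The linear term absorbs the part of [eps * |z|^2] that is affine at [z0]:
   [|z|^2 = 2 Re (z0^* z) - |z0|^2 + |z - z0|^2]. *)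
pose c : Cplx R := cpx (2 * eps * complex.Re z0) (- (2 * eps * complex.Im z0)).
pose f1 z := f z + c * z.
have dlin z : derivable (fun z => c * z) z 1.
  by apply: derivableM => //; exact: derivable_id.
apply: (@no_strict_max R f1 z0 rho eps) => //.
- apply: (@continuousD (Cplx R) (Cplx R) _ f (fun z => c * z)); first by apply: cf; exact: ltW.
  by apply: differentiable_continuous; exact/derivable1_diffP.
- move=> z zz0; apply: derivableD => //.
  apply: df; first exact: near_n0 zz0.
  by apply: near_z0; case/andP: zz0.
- move=> z zz0; have : g z <= g z0.
    by apply: z0max; rewrite inE/= ltW// near_z0.
  rewrite /g /f1 !Re_add !Re_mul/= !sqr_modulus !(Re_add, Im_add) !(Re_opp, Im_opp).
  set a := complex.Re _; set b := complex.Im _.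
  set a' := complex.Re z0; set b' := complex.Im z0.
  by lra.
Qed.

End maximum_principle.

(** * Separation of a point from a convex set *)

Section separation.
Context {R : realType} {n : nat}.
Implicit Types (u v p q : 'rV[Cplx R]_n) (K : set 'rV[Cplx R]_n).

(** The Euclidean inner product of [R^(2n)]; the ambient sup norm would not support a closest-point
    argument. *)
Definition rdot u v : R := \sum_i
  (complex.Re (u ord0 i) * complex.Re (v ord0 i) +
   complex.Im (u ord0 i) * complex.Im (v ord0 i)).

Lemma rdot_ge0 u : 0 <= rdot u u.
Proof. by apply: sumr_ge0 => i _; rewrite addr_ge0// -expr2 sqr_ge0. Qed.

Lemma rdotDr u v w : rdot u (v + w) = rdot u v + rdot u w.
Proof.
rewrite /rdot -big_split; apply: eq_bigr => i _ /=.
by rewrite mxE Re_add Im_add; ring.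
Qed.

Lemma rdot_sqrBZ (t : R) u v :
  rdot (u - real_to_C t *: v) (u - real_to_C t *: v) =
  rdot u u - 2 * t * rdot u v + t ^+ 2 * rdot v v.
Proof.
rewrite /rdot !mulr_sumr -sumrB -big_split; apply: eq_bigr => i _ /=.
by rewrite !mxE !(Re_add, Im_add, Re_opp, Im_opp, Re_mul, Im_mul)/=; ring.
Qed.

(** Exhibits the real functional as the real part of a complex linear one, whose composition with a
    holomorphic map is again holomorphic. *)
Lemma rdot_linear u v :
  rdot u v = complex.Re (\sum_i (u ord0 i)^* * v ord0 i).
Proof.
have -> (I : Type) (r : seq I) (F : I -> Cplx R) :
    complex.Re (\sum_(i <- r) F i) = \sum_(i <- r) complex.Re (F i).
  by elim: r => [|j r IH]; rewrite ?big_nil// !big_cons Re_add IH.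
apply: eq_bigr => i _; rewrite Re_mul /=.
by case: (u ord0 i) => a b /=; ring.
Qed.

Definition convex_rV K := forall u v (t : R), 0 <= t <= 1 -> K u -> K v ->
  K (u + real_to_C t *: (v - u)).

(* A nearly closest point of [K] is enough, so no compactness is needed. *)
Lemma separation K p (e D : R) : convex_rV K -> K !=set0 -> 0 < e ->
  (forall k, K k -> e <= rdot (p - k) (p - k)) ->
  (forall k k', K k -> K k' -> rdot (k - k') (k - k') <= D) ->
  exists u (alpha : R), (forall k, K k -> rdot u k <= alpha) /\ alpha < rdot u p.
Proof.
move=> cvxK [k0 Kk0] e0 far diam.
pose S := [set rdot (p - k) (p - k) | k in K].
have S0 : S !=set0 by exists (rdot (p - k0) (p - k0)), k0.
have Slb : has_lbound S by exists e => _ [k Kk <-]; exact: far.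
pose m := inf S.
have em : e <= m by apply: lb_le_inf => // _ [k Kk <-]; exact: far.
have m0 : 0 < m by exact: lt_le_trans em.
have D0 : 0 <= D by exact: le_trans (rdot_ge0 _) (diam k0 k0 Kk0 Kk0).
(* Moving from [q] towards [k] by the fraction [t] changes the squared distance by
   [- 2 t <p - q, k - q>] plus at most [t * m / 2]. As [q] is minimal up to [t * m / 2], the inner
   product is at most [m / 2]. *)
pose t := Num.min 1 (m / (2 * (D + 1))).
have t0 : 0 < t by rewrite lt_min ltr01 divr_gt0//; lra.
have t1 : 0 <= t <= 1 by rewrite ltW//= ge_min lexx.
have tD : t * D <= m / 2.
  have : t * (2 * (D + 1)) <= m.
    by rewrite -ler_pdivlMr ?ge_min ?lexx ?orbT//; lra.
  lra.
have d0 : 0 < t * m / 2 by rewrite divr_gt0// mulr_gt0.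
have [_ [q Kq <-] qm] : exists2 x, S x & x < m + t * m / 2.
  by apply: inf_adherent.
exists (p - q), (rdot (p - q) q + m / 2); split=> [k Kk|].
  have := ge_inf Slb (imageP (fun k => rdot (p - k) (p - k)) (cvxK q k t t1 Kq Kk)).
  rewrite -/m opprD addrA rdot_sqrBZ => mle.
  have := diam _ _ Kk Kq => Dle.
  have -> : rdot (p - q) k = rdot (p - q) q + rdot (p - q) (k - q).
    by rewrite -rdotDr [q + _]addrC subrK.
  rewrite lerD2l -(ler_pM2l t0).
  have : t ^+ 2 * rdot (k - q) (k - q) <= t * (m / 2).
    rewrite expr2 -mulrA ler_pM2l// (le_trans _ tD)// ler_pM2l//.
  move: mle qm d0; set A := rdot _ _; set B := rdot _ _; set C := rdot _ _.
  lra.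
have -> : rdot (p - q) p = rdot (p - q) q + rdot (p - q) (p - q).
  by rewrite -rdotDr [q + _]addrC subrK.
rewrite ltrD2l (lt_le_trans (y := m))//; first lra.
by apply: (ge_inf Slb); exists q.
Qed.

End separation.

(** * Maximum principle for maps into a convex set *)

Section convex_maximum_principle.
Context {R : realType} {n : nat}.
Implicit Types (u v w p : 'rV[Cplx R]_n) (W : set 'rV[Cplx R]_n) (z : Cplx R).

Lemma convexC_rV W : convexC W -> convex_rV W.
Proof.
move=> cW u v t t01 Wu Wv.
have t01' : 0 <= real_to_C t <= 1 by rewrite (real_to_C_le 0) (real_to_C_le _ 1).
have := cW v u (Itv01 (andP t01').1 (andP t01').2) (mem_set Wv) (mem_set Wu).
rewrite inE/=; set x := conv _ _ _.
suff -> : x = u + real_to_C t *: (v - u) by [].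
by rewrite /x /conv/= scalerBl scale1r scalerBr addrCA.
Qed.

Lemma open_rV_modulus W w : open W -> W w ->
  exists2 e : R, 0 < e & forall v, (forall i, modulus (v ord0 i - w ord0 i) < e) -> W v.
Proof.
rewrite openE => oW /oW /nbhs_ballP[d /= d0 H].
have dE : d = real_to_C (complex.Re d) by rewrite /real_to_C RRe_real// gtr0_real.
exists (complex.Re d); first by move: d0; rewrite dE (real_to_C_lt 0).
move=> v hv; apply: H; split => // i j; rewrite (ord1 i).
by rewrite /ball/= distrC dE norm_modulus real_to_C_lt; exact: hv.
Qed.

Lemma rdot_le_modulus w (M : R) : 0 <= M -> (forall i, modulus (w ord0 i) <= M) ->
  rdot w w <= n%:R * M ^+ 2.
Proof.
move=> M0 wM; rewrite mulr_natl -[n in _ *+ n]card_ord -sumr_const.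
by apply: ler_sum => i _; rewrite -!expr2 -sqr_modulus lerXn2r// ?nnegrE// modulus_ge0.
Qed.

Lemma modulus_lt_rdot w (e : R) i : 0 < e -> rdot w w < e ^+ 2 ->
  modulus (w ord0 i) < e.
Proof.
move=> e0 h; rewrite -(@ltr_pXn2r _ 2) ?nnegrE ?modulus_ge0 ?(ltW e0)//.
apply: le_lt_trans h; rewrite sqr_modulus /rdot (bigD1 i)//= !expr2 lerDl.
by apply: sumr_ge0 => j _; rewrite addr_ge0// -expr2 sqr_ge0.
Qed.

(** By compactness the image of the circle lies in a slightly shrunken copy [K] of [W]. A value
    outside [W] has positive distance from [K], and a functional separating it from [K] contradicts
    the scalar maximum principle. *)
Lemma convex_maximum_principle W (M r : R) (psi : Cplx R -> 'rV[Cplx R]_n) :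
  open W -> W 0 -> convex_rV W -> (forall w, W w -> forall i, modulus (w ord0 i) <= M) ->
  (forall i z, modulus z <= r -> {for z, continuous (fun z => psi z ord0 i)}) ->
  (forall i z, z != 0 -> modulus z < r -> derivable (fun z => psi z ord0 i) z 1) ->
  (forall z, modulus z = r -> W (psi z)) ->
  forall z, modulus z <= r -> W (psi z).
Proof.
move=> oW W0 cvxW bW cpsi dpsi Wpsi z1 z1r.
have [d d0 Wd] := open_rV_modulus oW W0.
pose Mb := `|M| + 1; have Mb0 : 0 < Mb by rewrite ltr_wpDl.
have [t t1 Wt] : exists2 t : R, 1 < t &
    forall z, modulus z = r -> W (real_to_C t *: psi z).
  have cptC : compact [set z : Cplx R | modulus z = r].
    apply: (@subclosed_compact _ _ [set z : Cplx R | modulus z <= r]).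
    - have -> : [set z : Cplx R | modulus z = r] = (@modulus R) @^-1` [set x | x = r] by [].
      apply: (@closed_comp _ _ (@modulus R) [set x | x = r]); last exact: closed_eq.
      by move=> z _; exact: continuous_modulus.
    - exact: compact_closed_disc.
    - by move=> z /= ->.
  have : \forall t \near (1 : R)^'+,
      [set z : Cplx R | modulus z = r] `<=` (fun z => W (real_to_C t *: psi z)).
    apply: (iffLR (compact_near_coveringP _)) => // z zr.
    have [e e0 We] := open_rV_modulus oW (Wpsi z zr).
    have e2 : 0 < e / 2 by lra.
    (* From [t psi z' - psi z = (t - 1) psi z' + (psi z' - psi z)], where the coordinates of
       [psi z'] are at most [Mb + e / 2]. *)
    exists ([set z' | forall i, modulus (psi z' ord0 i - psi z ord0 i) < e / 2],
            [set t : R | 1 < t /\ (t - 1) * (Mb + e / 2) < e / 2]) => /=.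
      split.
        have : \forall z' \near z, forall i, modulus (psi z' ord0 i - psi z ord0 i) < e / 2.
          apply: (@filter_forall _ _
            (fun i z' => modulus (psi z' ord0 i - psi z ord0 i) < e / 2)
            (nbhs z) (nbhs_filter z)) => i.
          have := cpsi i z; rewrite zr => /(_ (lexx _)).
          move=> /(_ (fun w : Cplx R => modulus (w - psi z ord0 i) < e / 2)); apply.
          by apply/nbhs_modulusP; exists (e / 2).
        by [].
      have p0 : 0 < e / 2 / (Mb + e / 2) by rewrite divr_gt0//; lra.
      near=> t; split; first by near: t; exact: nbhs_right_gt.
      rewrite -ltr_pdivlMr; last lra.
      rewrite ltrBlDr addrC; near: t; apply: nbhs_right_lt; lra.
    move=> [z' t] /= [hz' [t1 ht]]; apply: We => i; rewrite mxE.
    have -> : real_to_C t * psi z' ord0 i - psi z ord0 i =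
        real_to_C (t - 1) * psi z' ord0 i + (psi z' ord0 i - psi z ord0 i).
      by rewrite /real_to_C rmorphB rmorph1/=; ring.
    rewrite (le_lt_trans (modulusD _ _))// modulusM modulus_real.
    rewrite ger0_norm; last lra.
    have h1 := bW _ (Wpsi z zr) i; have h2 := hz' i.
    have : modulus (psi z' ord0 i) <= Mb + e / 2.
      rewrite -(subrK (psi z ord0 i) (psi z' ord0 i)) (le_trans (modulusD _ _))//.
      by have := ler_norm M; rewrite /Mb; lra.
    rewrite -(@ler_pM2l _ (t - 1)); last lra.
    lra.
  move=> /(filterI (nbhs_right_gt 1)) /filter_ex[t [/= t1 Wt]].
  by exists t.
apply: contrapT => nW; set p := psi z1 in nW.
have t0 : 0 < t by lra.
pose K : set 'rV[Cplx R]_n := fun k => W (real_to_C t *: k).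
have tV : real_to_C t != 0 by rewrite /real_to_C (inj_eq (@complexI R) _ 0) gt_eqF.
have cvxK : convex_rV K.
  move=> u v s s01 Ku Kv; rewrite /K scalerDr scalerA mulrC -scalerA scalerBr.
  exact: cvxW.
have K0 : K !=set0 by exists 0; rewrite /K scaler0.
(* If [k] in [K] were closer than [b] to [p], then [v = t / (t - 1) (p - k)] would be in [W], and
   [p], the combination of [t k] and [v] with weights [1 / t] and [1 - 1 / t], would be too. *)
pose b := d * (t - 1) / t.
have b0 : 0 < b by rewrite divr_gt0// mulr_gt0//; lra.
have far k : K k -> b ^+ 2 <= rdot (p - k) (p - k).
  move=> Kk; rewrite leNgt; apply/negP => h; apply: nW.
  pose v := real_to_C (t / (t - 1)) *: (p - k).
  have Wv : W v.
    apply: Wd => i; rewrite [(0 : 'rV_n) _ _]mxE subr0 mxE modulusM modulus_real.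
    rewrite ger0_norm; last by rewrite divr_ge0//; lra.
    rewrite mulrC -ltr_pdivlMr; last by rewrite divr_gt0//; lra.
    rewrite invf_div mulrA; exact: modulus_lt_rdot.
  have t01 : 0 <= 1 - t^-1 <= 1.
    by rewrite subr_ge0 invf_le1// ltW//= lerBlDr lerDl invr_ge0 ltW.
  have := cvxW _ _ _ t01 Kk Wv.
  suff -> : real_to_C t *: k + real_to_C (1 - t^-1) *: (v - real_to_C t *: k) = p by [].
  apply/rowP => i; rewrite !mxE /real_to_C !(rmorphB, rmorph1, fmorphV, rmorphM)/=.
  field.
  rewrite -(rmorph1 (real_complex R)) -rmorphB !(inj_eq (@complexI R) _ 0)/=.
  by rewrite !gt_eqF//; lra.
have bK k k' : K k -> K k' -> rdot (k - k') (k - k') <= n%:R * (Mb + Mb) ^+ 2.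
  have kM k0 i : K k0 -> modulus (k0 ord0 i) <= Mb.
    move=> /bW/(_ i); rewrite mxE modulusM modulus_real gtr0_norm// => h.
    have := modulus_ge0 (k0 ord0 i); have := ler_norm M; rewrite /Mb; nra.
  move=> Kk Kk'; apply: rdot_le_modulus => [|i]; first lra.
  by rewrite !mxE (le_trans (modulusD _ _))// modulusN lerD ?kM.
have b20 : 0 < b ^+ 2 by rewrite exprn_gt0.
have [u [alpha [uK up]]] := separation cvxK K0 b20 far bK.
pose f z := \sum_i (u ord0 i)^* * psi z ord0 i.
pose g i z := (u ord0 i)^* * psi z ord0 i.
have fE : f = \sum_i g i by apply/funext => z; rewrite fct_sumE.
have : complex.Re (f z1) <= alpha.
  apply: (@maximum_principle R f r) => //.
  - move=> z zr; rewrite fE.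
    apply: (big_ind (fun h : Cplx R -> Cplx R => {for z, continuous h})).
    + exact: cst_continuous.
    + by move=> h1 h2; exact: continuousD.
    + move=> i _; apply: (@continuousM (Cplx R) _ (cst (u ord0 i)^*) (fun z => psi z ord0 i)).
        exact: cst_continuous.
      exact: cpsi.
  - move=> z z0 zr; rewrite fE.
    by apply: derivable_sum => i; apply: derivableM => //; exact: dpsi.
  - by move=> z zr; rewrite -rdot_linear; apply: uK; exact: Wt.
by rewrite -rdot_linear leNgt up.
Unshelve. all: by end_near. Qed.

End convex_maximum_principle.

(** * The Minkowski function along discs *)

Section quotient.
Context {R : realType}.

Lemma derivable_coord n (phi : Cplx R -> 'rV[Cplx R]_n) i z :
  derivable phi z 1 -> derivable (fun z => phi z ord0 i) z 1.
Proof.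
move=> /derivable1_diffP dphi; apply/derivable1_diffP.
apply: (@differentiable_comp _ _ _ _ phi (fun M : 'rV[Cplx R]_n => M ord0 i)) => //.
exact: differentiable_coord.
Qed.

(** The value of the quotient at 0 is the derivative of [f] there, which gives continuity at 0 as
    [maximum_principle] asks. *)
Lemma quotient_extension (f : Cplx R -> Cplx R) :
  (forall z, modulus z < 1 -> derivable f z 1) -> f 0 = 0 ->
  exists q : Cplx R -> Cplx R,
    [/\ forall z, z * q z = f z,
        forall z, modulus z < 1 -> {for z, continuous q} &
        forall z, z != 0 -> modulus z < 1 -> derivable q z 1].
Proof.
move=> df f0; have d0 : modulus (0 : Cplx R) < 1 by rewrite modulus0.
have [l Hl] := complex_expansion (df 0 d0).
pose q z := if z == 0 then l else f z * z^-1.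
have dq z : z != 0 -> modulus z < 1 -> derivable q z 1.
  move=> z0 z1; apply: (@near_eq_derivable _ _ _ (fun z => f z * z^-1)).
  - apply/nbhs_modulusP; exists (modulus z).
      by rewrite lt_neqAle modulus_ge0 eq_sym modulus_eq0 z0.
    move=> w wz; rewrite /q; case: eqP => // w0; move: wz.
    by rewrite w0 modulusB subr0 ltxx.
  - apply: derivableM; first exact: df.
    apply: derivableV => //; exact: derivable_id.
exists q; split=> [z|z|]; last exact: dq.
- by rewrite /q; case: eqP => [->|/eqP z0]; rewrite ?f0 ?mul0r// mulrCA divff ?mulr1.
- move=> z1; have [->|z0] := eqVneq z 0; last first.
    by apply: differentiable_continuous; exact/derivable1_diffP/dq.
  move=> A /nbhs_modulusP[e e0 HA].
  have [|dl dl0 H] := Hl (e / 2); first by rewrite divr_gt0.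
  apply/nbhs_modulusP; exists dl => // w wdl; apply: HA.
  rewrite /q eqxx; case: eqP => [_|/eqP w0]; first by rewrite subrr modulus0.
  have := H w wdl; rewrite f0 !subr0 => h.
  have w0' : 0 < modulus w by rewrite lt_neqAle modulus_ge0 eq_sym modulus_eq0 w0.
  have -> : f w * w^-1 - l = (f w - l * w) * w^-1 by field.
  rewrite modulusM modulusV ltr_pdivrMr//.
  by rewrite (le_lt_trans h)// ltr_pM2r//; lra.
Qed.

End quotient.

(** * The Minkowski function of a balanced open set *)

Section minkowski.
Context {R : realType} {n : nat} (d : 'I_n -> nat) (hd : forall i, (0 < d i)%N).
Context (Om : set 'rV[Cplx R]_n) (Om_open : open Om) (Om_ne : Om !=set0).
Context (Om_balanced : d_balanced d Om).
Implicit Types (w : 'rV[Cplx R]_n) (t : R).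

Let scaled w t : 'rV[Cplx R]_n := \row_i (w ord0 i / real_to_C t ^+ d i).

Lemma balanced0 : Om 0.
Proof.
have [w Omw] := Om_ne; have := @Om_balanced w 0 Omw.
rewrite normr0 ler01 => /(_ isT); congr Om.
by apply/rowP => i; rewrite !mxE expr0n eqn0Ngt hd mul0r.
Qed.

Lemma scaled_dilation w t t' : 0 < t ->
  weighted_dilation d (real_to_C (t / t')) (scaled w t) = scaled w t'.
Proof.
move=> t0; apply/rowP => i; rewrite !mxE /real_to_C fmorph_div/= expr_div_n.
rewrite mulrC -mulrA [_^-1 * (_ / _)]mulrA mulVf ?mul1r// expf_neq0//.
by rewrite (inj_eq (@complexI R) _ 0) gt_eqF.
Qed.

Lemma minkowski_le w t : 0 < t -> Om (scaled w t) -> minkowski_fun d Om w <= t.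
Proof. by move=> t0 Omt; apply: ge_inf => //; exists 0 => x [/ltW]. Qed.

Lemma minkowski_ge0 w : 0 <= minkowski_fun d Om w.
Proof.
rewrite /minkowski_fun; set S := [set _ | _].
have [->|S0] := eqVneq S set0; first by rewrite inf0.
by apply: lb_le_inf => [|x [/ltW]//]; exact/set0P.
Qed.

(** Some admissible [s < t] exists by definition of the infimum, and the dilation by [s / t] carries
    its membership over to [t]. *)
Lemma minkowski_lt w t : minkowski_fun d Om w < t -> Om (scaled w t).
Proof.
move=> ht; have t0 : 0 < t := le_lt_trans (minkowski_ge0 w) ht.
have [] : exists2 s, (0 < s /\ Om (scaled w s)) & s < t.
  apply: inf_lt ht.
  have [e e0 H] := open_rV_modulus Om_open balanced0.
  pose N := \sum_i modulus (w ord0 i).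
  have N0 : 0 <= N by apply: sumr_ge0 => i _; exact: modulus_ge0.
  have T1 : 1 <= 1 + N / e by rewrite lerDl divr_ge0// ltW.
  have T0 : 0 < 1 + N / e by lra.
  (* Nonemptiness of the set under [inf]. The witness is at least 1, hence below its own powers, and
     [e] times it is [e + N], more than any coordinate of [w]. *)
  exists (1 + N / e); split => //; apply: H => i; rewrite !mxE subr0.
  rewrite modulusM modulusV modulusX modulus_real gtr0_norm//.
  rewrite ltr_pdivrMr ?exprn_gt0//.
  have wN : modulus (w ord0 i) <= N.
    by rewrite /N (bigD1 i)//= lerDl sumr_ge0// => j _; exact: modulus_ge0.
  have le_exp : 1 + N / e <= (1 + N / e) ^+ d i by rewrite ler_eXnr.
  rewrite (lt_le_trans _ (ler_wpM2l (ltW e0) le_exp))//.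
  by rewrite mulrDr mulr1 mulrCA divff ?gt_eqF// mulr1; lra.
move=> s [s0 Oms] st; rewrite -(scaled_dilation w t s0).
apply: Om_balanced => //; rewrite norm_modulus (real_to_C_le _ 1) modulus_real.
by rewrite gtr0_norm ?divr_gt0// ler_pdivrMr// mul1r ltW.
Qed.

End minkowski.

(** * The Schwarz lemma for the Minkowski function *)

Section schwarz.
Context {R : realType} {n : nat} (d : 'I_n -> nat) (hd : forall i, (0 < d i)%N).
Context (Om : set 'rV[Cplx R]_n) (Om_open : open Om) (Om_ne : Om !=set0).
Context (Om_balanced : d_balanced d Om) (Om_bounded : bounded_set Om).
Context (Om_convex : convexC Om).

Lemma bounded_set_modulus :
  exists M : R, forall w, Om w -> forall i, modulus (w ord0 i) <= M.
Proof.
have [M M0 H] := ex_strict_bound_gt0 Om_bounded.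
exists (complex.Re M) => w /H /= wM i.
have : ball (0 : 'rV[Cplx R]_n) M w by rewrite -ball_normE /ball_/= sub0r normrN.
move=> [_ /(_ ord0 i)]; rewrite mxE /ball/= sub0r normrN.
rewrite norm_modulus -(RRe_real (gtr0_real M0)) => /ltW.
by rewrite [_ <= _]real_to_C_le.
Qed.

Lemma derivable_exprn k (z : Cplx R) : derivable (fun z : Cplx R => z ^+ k) z 1.
Proof.
have -> : (fun z : Cplx R => z ^+ k) = (@id (Cplx R)) ^+ k.
  by apply/funext => w; elim: k => [|k IH]; rewrite ?expr0// !exprS IH.
by apply: derivableX; exact: derivable_id.
Qed.

(** With [m] an [L]-th root of [s], the claim is [h <= B |m|]. Dilating the disc by [1 / c] for
    [c > B] lets the convex maximum principle act on [Om] itself; then [c] is taken close to [B]. *)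
Lemma schwarz_minkowski (phi : Cplx R -> 'rV[Cplx R]_n) (B : R) (L : nat) (s : Cplx R) :
  (0 < L)%N -> (forall i, (d i <= L)%N) -> 0 < B ->
  (forall z, modulus z < 1 -> derivable phi z 1) -> phi 0 = 0 ->
  (forall z, modulus z < 1 -> minkowski_fun d Om (phi z) <= B) ->
  modulus s < 1 -> (minkowski_fun d Om (phi s) / B) ^+ L <= modulus s.
Proof.
move=> L0 dL B0 dphi phi0 hB s1; set h := minkowski_fun _ _ _.
have h0 : 0 <= h := minkowski_ge0 _ _ _.
have [m mL] : exists m : Cplx R, m ^+ L = s by exists (L.-root s); rewrite rootCK.
rewrite -mL modulusX lerXn2r ?nnegrE ?modulus_ge0 ?divr_ge0 ?(ltW B0)//.
rewrite ler_pdivrMr//.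
have m1 : modulus m < 1.
  by rewrite -(@ltr_pXn2r _ L) ?nnegrE ?modulus_ge0// expr1n -modulusX mL.
have ext i : exists q : Cplx R -> Cplx R,
    [/\ forall z, z * q z = phi z ord0 i,
        forall z, modulus z < 1 -> {for z, continuous q} &
        forall z, z != 0 -> modulus z < 1 -> derivable q z 1].
  apply: quotient_extension; last by rewrite phi0 mxE.
  by move=> z z1; apply: derivable_coord; exact: dphi.
have [q qP] := choice ext.
have XL1 (z : Cplx R) : modulus z < 1 -> modulus (z ^+ L) < 1.
  by move=> z1; rewrite modulusX exprn_ilt1 ?modulus_ge0// -lt0n.
(* This is [phi_i(z^L) / (c z)^(d i)], with the division by [z] carried out through [q i];
   [d i <= L] makes the subtraction exact. *)
pose psi c (z : Cplx R) : 'rV[Cplx R]_n :=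
  \row_i (real_to_C c ^- d i * (z ^+ (L - d i) * q i (z ^+ L))).
have psiE c z i : 0 < c ->
    (real_to_C c * z) ^+ d i * psi c z ord0 i = phi (z ^+ L) ord0 i.
  move=> c0; have cN0 : real_to_C c != 0 by rewrite (inj_eq (@complexI R) _ 0) gt_eqF.
  rewrite mxE exprMn mulrACA divff ?expf_neq0// mul1r mulrA -exprD subnKC//.
  by case: (qP i) => ->.
have Xcont k : continuous (fun z : Cplx R => z ^+ k).
  by move=> z; apply: differentiable_continuous; exact/derivable1_diffP/derivable_exprn.
have psi_in c : B < c -> Om (psi c m).
  move=> Bc; have c0 : 0 < c by exact: lt_trans Bc.
  have Bc1 : B / c < 1 by rewrite ltr_pdivrMr// mul1r.
  (* The circle must enclose [m], and [B < c * r] puts the dilation of [phi (z ^+ L)] by [1 / (c r)]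
     in [Om]. *)
  have [r [mr r1 Bcr]] : exists r, [/\ modulus m < r, r < 1 & B / c < r].
    exists ((Num.max (modulus m) (B / c) + 1) / 2).
    have [h1 h2] : modulus m <= Num.max (modulus m) (B / c) /\
                   B / c <= Num.max (modulus m) (B / c).
      by rewrite !le_max !lexx orbT.
    have : Num.max (modulus m) (B / c) < 1 by rewrite gt_max m1.
    by move=> h3; split; lra.
  have r0 : 0 < r := le_lt_trans (modulus_ge0 m) mr.
  have [M OmM] := bounded_set_modulus.
  apply: (convex_maximum_principle (r := r) Om_open (balanced0 hd Om_ne Om_balanced)
            (convexC_rV Om_convex) OmM); last exact: ltW.
  - move=> i z zr; have z1 : modulus z < 1 := le_lt_trans zr r1.
    have -> : (fun z : Cplx R => psi c z ord0 i) =
        (fun z : Cplx R => real_to_C c ^- d i * (z ^+ (L - d i) * q i (z ^+ L))).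
      by apply/funext => w; rewrite mxE.
    apply: (@continuousM (Cplx R) _ (cst (real_to_C c ^- d i))
      (fun z : Cplx R => z ^+ (L - d i) * q i (z ^+ L))); first exact: cst_continuous.
    apply: (@continuousM (Cplx R) _ (fun z : Cplx R => z ^+ (L - d i))
      (fun z : Cplx R => q i (z ^+ L))).
      exact: Xcont.
    apply: (@continuous_comp _ _ _ (fun z : Cplx R => z ^+ L) (q i)); first exact: Xcont.
    by have [_ + _] := qP i; apply; exact: XL1.
  - move=> i z z0 zr; have z1 : modulus z < 1 := lt_trans zr r1.
    have -> : (fun z : Cplx R => psi c z ord0 i) =
        (fun z : Cplx R => real_to_C c ^- d i * (z ^+ (L - d i) * q i (z ^+ L))).
      by apply/funext => w; rewrite mxE.
    apply: (@derivableM (Cplx R) _ (cst (real_to_C c ^- d i))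
      (fun z : Cplx R => z ^+ (L - d i) * q i (z ^+ L))); first exact: derivable_cst.
    apply: (@derivableM (Cplx R) _ (fun z : Cplx R => z ^+ (L - d i))
      (fun z : Cplx R => q i (z ^+ L))).
      exact: derivable_exprn.
    apply/derivable1_diffP.
    apply: (@differentiable_comp _ _ _ _ (fun z : Cplx R => z ^+ L) (q i)).
      exact/derivable1_diffP/derivable_exprn.
    apply/derivable1_diffP; have [_ _] := qP i; apply; last exact: XL1.
    by rewrite expf_neq0.
  - move=> z zr; have z1 : modulus z < 1 by rewrite zr.
    have cr0 : 0 < c * r by rewrite mulr_gt0.
    have hz : minkowski_fun d Om (phi (z ^+ L)) < c * r.
      by rewrite (le_lt_trans (hB _ (XL1 _ z1)))// mulrC -ltr_pdivrMr.
    have := minkowski_lt hd Om_open Om_ne Om_balanced hz.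
    (* The factor [r / z] is unimodular on the circle and turns the dilation by [1 / (c r)] into
       that by [1 / (c z)]. *)
    move=> /Om_balanced - /(_ (real_to_C r / z)).
    have z0 : z != 0 by rewrite -modulus_eq0 zr gt_eqF.
    rewrite norm_modulus (real_to_C_le _ 1) modulusM modulusV modulus_real zr.
    rewrite gtr0_norm// divff ?gt_eqF// lexx => /(_ isT).
    congr Om; apply/rowP => i; rewrite mxE [X in _ * X]mxE -(psiE c z i c0).
    have cN0 : real_to_C c != 0 by rewrite (inj_eq (@complexI R) _ 0) gt_eqF.
    have rN0 : real_to_C r != 0 by rewrite (inj_eq (@complexI R) _ 0) gt_eqF.
    rewrite [real_to_C (c * r)]rmorphM/= -/(real_to_C c) -/(real_to_C r).
    move: (psi c z ord0 i) (real_to_C c) (real_to_C r) cN0 rN0 => x C r' cN0 rN0.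
    rewrite !exprMn exprVn.
    move: (expf_neq0 (d i) cN0) (expf_neq0 (d i) rN0) (expf_neq0 (d i) z0).
    move: (C ^+ _) (r' ^+ _) (z ^+ _) => {}C {}r' w {}cN0 {}rN0 wN0.
    by field; rewrite cN0 rN0 wN0.
rewrite leNgt; apply/negP => hlt.
have mB0 : 0 <= B * modulus m by rewrite mulr_ge0 ?modulus_ge0// ltW.
pose t := (B * modulus m + h) / 2.
have t0 : 0 < t by rewrite /t; lra.
have m10 : 0 < modulus m + 1 by rewrite ltr_wpDl// modulus_ge0.
(* Chosen above [B] with [c |m| <= t]; dividing by [|m| + 1] covers [m = 0]. *)
pose c := B + (t - B * modulus m) / (modulus m + 1).
have Bc : B < c by rewrite ltrDl divr_gt0// /t; lra.
have c0 : 0 < c := lt_trans B0 Bc.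
have mct : c * modulus m <= t.
  have -> : c * modulus m =
      B * modulus m + (t - B * modulus m) * (modulus m / (modulus m + 1)).
    by rewrite /c; field; rewrite gt_eqF.
  rewrite -lerBrDl ler_piMr//; first by rewrite /t; lra.
  by rewrite ler_pdivrMr// mul1r lerDl.
suff : h <= t by rewrite /t; lra.
apply: minkowski_le => //.
have := Om_balanced (lam := real_to_C c * m / real_to_C t) (psi_in c Bc).
rewrite norm_modulus (real_to_C_le _ 1) !modulusM modulusV !modulus_real.
rewrite !gtr0_norm// ler_pdivrMr// mul1r => /(_ mct).
congr Om; apply/rowP => i; rewrite [LHS]mxE [RHS]mxE -mL -(psiE c m i c0).
by rewrite expr_div_n mulrAC.
Qed.

End schwarz.

(** * Hyperbolic tangent and Poincaré distance from the origin *)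

Section hyperbolic.
Context {R : realType}.
Implicit Types x y : R.

Lemma tanhE x : tanh x = 1 - 2 / (expR (2 * x) + 1).
Proof.
have e0 := expR_gt0 x; have e20 := expR_gt0 (2 * x).
have -> : expR (2 * x) = expR x * expR x.
  by rewrite -expRD; congr expR; ring.
rewrite /tanh expRN; field.
by rewrite !gt_eqF// addr_gt0// mulr_gt0.
Qed.

Lemma le_tanh x y : x <= y -> tanh x <= tanh y.
Proof.
move=> xy; rewrite !tanhE lerD2l lerN2 ler_pM2l//.
have := expR_gt0 (2 * x); have := expR_gt0 (2 * y) => e1 e2.
by rewrite lef_pV2 ?posrE ?addr_gt0// lerD2r ler_expR ler_pM2l.
Qed.

Lemma artanhK x : 0 <= x < 1 -> tanh (artanh x) = x.
Proof.
move=> /andP[x0 x1]; rewrite tanhE /artanh mulrA divff// mul1r lnK; last first.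
  by rewrite posrE divr_gt0//; lra.
by field; rewrite !gt_eqF//; lra.
Qed.

Lemma le_artanh x y : 0 <= x -> x <= y -> y < 1 -> artanh x <= artanh y.
Proof.
move=> x0 xy y1; rewrite /artanh ler_pM2l ?invr_gt0//.
rewrite ler_ln ?posrE ?divr_gt0//; try lra.
rewrite ler_pdivrMr; last lra.
rewrite mulrAC ler_pdivlMr; last lra.
nra.
Qed.

Lemma poincare0 (s : Cplx R) : poincare 0 s = artanh (modulus s).
Proof. by rewrite /poincare rmorph0 mul0r subr0 divr1 sub0r modulusN. Qed.

End hyperbolic.

(** * Lower bounds for the Lempert function *)

Section lempert_bound.
Context {R : realType} {n : nat} (d : 'I_n -> nat) (hd : forall i, (0 < d i)%N).
Context (Om : set 'rV[Cplx R]_n) (Om_open : open Om) (Om_balanced : d_balanced d Om).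

(** The factors [r ^- d i] tend to 1 as [r] tends to 1 from below, and [Om] is open. *)
Lemma dilated_point w : Om w ->
  exists r : R, [/\ 0 < r, r < 1 & Om (\row_i (w ord0 i / real_to_C r ^+ d i))].
Proof.
move=> Omw; have [e e0 H] := open_rV_modulus Om_open Omw.
pose N := 1 + \sum_i modulus (w ord0 i).
have wN i : modulus (w ord0 i) <= N.
  rewrite /N (bigD1 i)//= addrCA lerDl addr_ge0// sumr_ge0// => j _.
  exact: modulus_ge0.
have N0 : 0 < N by rewrite ltr_pwDl// sumr_ge0// => j _; exact: modulus_ge0.
have : \forall r \near (1 : R)^'-, forall i, `|1 - r ^- d i| < e / N.
  apply: filter_forall => i; apply: cvg_within.
  have : {for (1 : R), continuous (fun r : R => (r ^+ d i)^-1)}.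
    apply: (@cvgV R R (nbhs (1 : R)) _ (fun r => r ^+ d i)); first by rewrite expr1n oner_eq0.
    exact: exprn_continuous.
  move=> /cvgrPdist_lt /(_ (e / N)); rewrite expr1n invr1; apply.
  by rewrite divr_gt0.
move=> H1; near (1 : R)^'- => r.
have r0 : 0 < r by near: r; exact: nbhs_left_gt.
have r1 : r < 1 by near: r; exact: nbhs_left_lt.
have H2 : forall i, `|1 - r ^- d i| < e / N by near: r.
exists r; split => //; apply: H => i; rewrite mxE.
have -> : w ord0 i / real_to_C r ^+ d i - w ord0 i =
    w ord0 i * real_to_C (r ^- d i - 1).
  rewrite /real_to_C rmorphB rmorph1 fmorphV rmorphXn/= mulrBr mulr1//.
rewrite modulusM modulus_real distrC.
rewrite (@le_lt_trans _ _ (N * `|1 - r ^- d i|))//.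
  by rewrite ler_wpM2r.
by rewrite mulrC -ltr_pdivlMr.
Unshelve. all: by end_near. Qed.

(** The orbit of a slightly stretched point under the dilations reaches the given point at the
    parameter [r < 1]. This makes the infimum in [lempert] one of a nonempty set, also for
    [a = 0]. *)
Lemma dilation_disc (a : R) w : Om w -> exists s phi,
  [/\ unit_disc s, holomorphic_disc (scale_set a Om) phi, phi 0 = 0 &
      phi s = real_to_C a *: w].
Proof.
move=> /dilated_point[r [r0 r1 Omr]]; set v := \row_i _ in Omr.
pose phi (l : Cplx R) := real_to_C a *: weighted_dilation d l v.
exists (real_to_C r), phi; split.
- by rewrite /unit_disc/= norm_modulus modulus_real (real_to_C_lt _ 1) gtr0_norm.
- move=> l l1; split; first by exists (weighted_dilation d l v) => //; exact/Om_balanced/ltW.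
  (* A sum of scalar monomials times fixed vectors, which is differentiable term by term. *)
  have -> : phi = \sum_i (fun l : Cplx R =>
      l ^+ d i *: ((real_to_C a * v ord0 i) *: delta_mx ord0 i)).
    apply/funext => z; rewrite fct_sumE; apply/rowP => i.
    rewrite summxE (bigD1 i)//= big1 ?addr0 => [|j ji]; rewrite !mxE eqxx/=.
      by rewrite mulr1 mulrCA.
    by rewrite eq_sym (negbTE ji) !mulr0.
  apply: derivable_sum => i; apply/derivable1_diffP; apply: differentiableZl.
  exact/derivable1_diffP/derivable_exprn.
- by apply/rowP => i; rewrite !mxE expr0n eqn0Ngt hd mul0r mulr0.
- congr (_ *: _); apply/rowP => i; rewrite !mxE mulrC divfK//.
  by rewrite expf_neq0// (inj_eq (@complexI R) _ 0) gt_eqF.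
Qed.

(** A bound on every competing [modulus s] passes to the infimum through the monotone [artanh], and
    back through [tanh]. The first premise excludes the default value of [inf] on the empty set. *)
Lemma le_lempert (G : set 'rV[Cplx R]_n) z (x : R) :
  (exists s phi, [/\ unit_disc s, holomorphic_disc G phi, phi 0 = 0 & phi s = z]) ->
  0 <= x ->
  (forall s phi, unit_disc s -> holomorphic_disc G phi -> phi 0 = 0 -> phi s = z ->
     x <= modulus s) ->
  x <= tanh (lempert G 0 z).
Proof.
have disc1 (s : Cplx R) : unit_disc s -> modulus s < 1.
  by rewrite /unit_disc/= norm_modulus (real_to_C_lt _ 1).
move=> [s0 [phi0 [s01 hphi0 phi00 phis0]]] x0 H.
have x1 : x < 1 := le_lt_trans (H _ _ s01 hphi0 phi00 phis0) (disc1 _ s01).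
rewrite -[leLHS]artanhK; last by rewrite x0.
apply: le_tanh; apply: lb_le_inf.
  by exists (poincare 0 s0); exists s0 => //; split => //; exists phi0.
move=> _ [s [s1 [phi [h1 h2 h3]]] <-]; rewrite poincare0.
by apply: le_artanh => //; [exact: H h1 h2 h3|exact: disc1].
Qed.

End lempert_bound.

Theorem lemma4p8 (R : realType) (n : nat) (hn : (2 <= n)%N)
    (d : 'I_n -> nat) (hd : forall i, (0 < d i)%N)
    (Om : set 'rV[Cplx R]_n)
    (Om_domain : is_domain Om) (Om_bounded : bounded_set Om)
    (Om_convex : convexC Om) (Om_balanced : d_balanced d Om)
    (a B : R) (B_gt0 : 0 < B)
    (hB : forall z, scale_set a Om z -> minkowski_fun d Om z <= B)
    (z : 'rV[Cplx R]_n) (hz : scale_set a Om z) :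
  minkowski_fun d Om z <=
    B * tanh (lempert (scale_set a Om) 0 z)
          `^ ((\max_(i < n) d i)%:R^-1).
Proof.
have [Om_open _ Om_ne] := Om_domain.
set L := (\max_(i < n) d i)%N.
have dL i : (d i <= L)%N by exact: leq_bigmax.
have L0 : (0 < L)%N.
  by apply: leq_trans (dL (Ordinal (ltnW hn))); exact: hd.
set h := minkowski_fun d Om z; have h0 : 0 <= h := minkowski_ge0 _ _ _.
rewrite -ler_pdivrMl// mulrC.
have hB0 : 0 <= h / B by rewrite divr_ge0// ltW.
(* In [L]-th power form the bound is the one [schwarz_minkowski] gives for each disc; the exponent
   [1 / L] is restored by monotonicity of [powR]. *)
suff tL : (h / B) ^+ L <= tanh (lempert (scale_set a Om) 0 z).
  apply: (@le_trans _ _ (((h / B) ^+ L) `^ (L%:R^-1))); last first.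
    apply: ge0_ler_powR => //; rewrite ?nnegrE ?invr_ge0 ?ler0n ?exprn_ge0//.
    by apply: le_trans tL; rewrite exprn_ge0.
  rewrite -powR_mulrn// -powRrM divff ?powRr1//.
  by rewrite pnatr_eq0 -lt0n.
apply: le_lempert => [||s phi s1 hphi phi0 phis].
- by case: hz => w Omw <-; exact: (dilation_disc hd Om_open Om_balanced).
- by rewrite exprn_ge0.
have discE (u : Cplx R) : modulus u < 1 -> unit_disc u.
  by rewrite /unit_disc/= norm_modulus (real_to_C_lt _ 1).
rewrite /h -phis; apply: (schwarz_minkowski hd) => //.
- by move=> u /discE/hphi[].
- by move=> u /discE/hphi[Gu _]; exact: hB.
- by move: s1; rewrite /unit_disc/= norm_modulus (real_to_C_lt _ 1).
Qed.
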